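(* Let $(w_n)_{n\ge 1}$ be a sequence of integers with $w_n>1$ for all $n$, and let $\Theta$ be the solenoid of type $\varpi=(w_1,w_2,\dots,w_n,\dots)$. Let $r\ge 1$ be an integer and let $\pi:X\to\Theta$ be an $r$-fold covering. Then each connected component of $X$ (with the subspace topology) is homeomorphic to $\Theta$.
   Context: Let $S^1=\{z\in\mathbb{C} : |z|=1\}$. Given a sequence of integers $\varpi=(w_1,w_2,\dots,w_n,\dots)$ with every $w_n>1$, let $\phi_n:S^1\to S^1$ be $\phi_n(x)=x^{w_n}$ for $n\ge 1$. The solenoid of type $\varpi$ is the inverse limit $$\Theta=\{(x_0,x_1,\dots,x_n,\dots) : x_n\in S^1 \text{ for } n\ge 0,\ x_{n-1}=\phi_n(x_n) \text{ for } n\ge 1\}\subset\prod_{n=0}^\infty S^1,$$ with the subspace topology of the product topology. (By convention the circle itself is not considered a solenoid; this is reflected in the requirement $w_n>1$.) An $r$-fold covering is a covering map all of whose fibers have exactly $r$ points; the total space $X$ is not assumed connected. *)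

(* Defs.v *)
From HB Require Import structures.
From mathcomp Require Import all_boot all_order all_algebra.
From mathcomp Require Import complex.
From mathcomp Require Import all_classical all_reals all_analysis.

Set Implicit Arguments.
Unset Strict Implicit.
Unset Printing Implicit Defensive.

Import Order.TTheory GRing.Theory Num.Theory.
Import numFieldNormedType.Exports.

Local Open Scope classical_set_scope.
Local Open Scope ring_scope.
Local Open Scope complex_scope.
Local Open Scope card_scope.

Definition homeomorphism (S T : topologicalType) (f : S -> T) : Prop :=
  continuous f /\
  exists g : T -> S, [/\ continuous g, cancel f g & cancel g f].

Definition homeomorphic (S T : topologicalType) : Prop :=
  exists f : S -> T, homeomorphism f.

(* The sheets are the members of [F]; [V] and [U] carry the subspace topology
   when coerced to types, and [f] is the restriction of [p] to [V] and [U]. *)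
Definition evenly_covered (X B : topologicalType) (p : X -> B) (U : set B)
    : Prop :=
  exists F : set (set X),
    [/\ trivIset F id,
        p @^-1` U = \bigcup_(V in F) V &
        forall V, F V -> open V /\
          exists f : V -> U,
            homeomorphism f /\ forall v : V, set_val (f v) = p (set_val v)].

Definition covering_map (X B : topologicalType) (p : X -> B) : Prop :=
  continuous p /\
  forall b : B, exists U : set B, open_nbhs b U /\ evenly_covered p U.

Definition fold_covering (r : nat) (X B : topologicalType) (p : X -> B)
    : Prop :=
  covering_map p /\ forall b : B, p @^-1` [set b] #= `I_r.

(* [R[i]^o] is [R[i]] seen as a normed module over itself, which is how it
   gets the topology of its modulus. *)
Definition circle (R : realType) : set R[i]^o := [set z | `|z| = 1].
Arguments circle : clear implicits.

Lemma circle_expP (R : realType) (k : nat) (z : circle R) :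
  (set_val z : R[i]^o) ^+ k \in circle R.
Proof.
apply/mem_set; rewrite /circle /= normrX.
by have /= -> := set_valP z; rewrite expr1n.
Qed.

Definition circle_exp (R : realType) (k : nat) (z : circle R) : circle R :=
  exist _ ((set_val z : R[i]^o) ^+ k) (circle_expP k z).

(* The exponents are [w 1], [w 2], ...; the value [w 0] is not used. *)
Definition solenoid (R : realType) (w : nat -> nat)
    : set {ptws nat -> circle R} :=
  [set x | forall n, (0 < n)%N -> x n.-1 = circle_exp (w n) (x n)].
Arguments solenoid : clear implicits.

(* Main.v *)
(** Write the solenoid Theta additively: it is a compact abelian group with a
one-parameter subgroup [flow], and for K_n the kernel of the n-th coordinate
the map (t, k) |-> flow t + k is onto Theta from R x K_n, with kernel generated
by c_n = (W_n, - flow W_n), where W_n = w_1 ... w_n.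

Since X is compact Hausdorff, "stay in the same small sheet" lifts translation
by small elements of Theta to X, uniformly and compatibly with sums.  A small
neighbourhood of 0 contains some K_n0 together with a piece of the flow, so
this extends to an action of R x K_n0 on X that lifts translation.  Its orbits
are clopen.  For n >= n0 the element c_n permutes the finite fibre of x; choose
n such that the period D of x under c_n is minimal.  Then D is prime to w_m for
every m > n, since otherwise c_m would have a smaller period.  Hence
multiplication by D is bijective on K_n, and flow t + k |-> (D t, D k) . x is a
well-defined continuous injection of Theta onto the orbit of x under R x K_n.
That orbit is clopen and connected, so it is the component of x. *)
From HB Require Import structures.
Require Import Defs.
From mathcomp Require Import all_boot all_order all_algebra.
From mathcomp Require Import complex.
From mathcomp Require Import all_classical all_reals all_analysis.
From mathcomp Require Import lra zify.

Set Implicit Arguments.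
Unset Strict Implicit.
Unset Printing Implicit Defensive.

Import Order.TTheory GRing.Theory Num.Theory.
Import numFieldNormedType.Exports.

Local Open Scope classical_set_scope.
Local Open Scope ring_scope.

(** * Lifting small translations through a covering *)

Section near_diagonal.
Context {X : topologicalType}.
Hypotheses (hX : hausdorff_space X) (cX : compact [set: X]).

(** Neighbourhoods of the diagonal of a compact Hausdorff space form a uniformity. The form given
    here serves to compare a lift obtained by two small moves with one obtained by a single move. *)
Lemma near_diagonal_chain (P : X -> X -> Prop) :
  (forall v : X, nbhs (v, v) [set y | P y.1 y.2]) ->
  exists2 E : set (X * X), (forall v : X, nbhs (v, v) E) &
    forall v v1 v2 v3, E (v, v1) -> E (v1, v2) -> E (v, v3) -> P v2 v3.
Proof.
move=> nP.
pose D : set (X * X) := [set y | y.1 = y.2].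
have DE (E : set (X * X)) : set_nbhs D E <-> forall v : X, nbhs (v, v) E.
  split=> [h v|h [a b]]; first exact: (h (v, v)).
  by rewrite /D/= => <-.
(* Regularity fits [closure C] inside the interior of [B]. Near a diagonal point outside [closure C]
   the condition on pairs is vacuous; near one inside, [B] is a neighbourhood. *)
have shrink (v : X) B : nbhs v B -> exists C,
    [/\ nbhs v C, C `<=` B & set_nbhs D [set y | closure C y.1 -> B y.2]].
  move=> nB; have [C vC CB] : filter_from (nbhs v) closure B°.
    by apply: (compact_regular hX cX); [exact: filterT|exact: nbhs_interior].
  exists C; split=> //; first by move=> u /subset_closure /CB /interior_subset.
  apply/DE => u.
  have [Cu|nCu] := pselect (closure C u).
    exists (setT, B) => /=; first by split; [exact: filterT|exact: CB].
    by move=> [a b] [_ Bb] _.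
  exists (~` closure C, setT) => /=; last by move=> [a b] [nCa _] /nCa.
  split; last exact: filterT.
  by apply: open_nbhs_nbhs; split => //; exact/closed_openC/closed_closure.
have [[x0 _]|X0] := pselect (exists x : X, True); last first.
  by exists setT => [v|v]; exfalso; apply: X0; exists v.
have PD : ProperFilter (set_nbhs D) by apply: set_nbhs_pfilter; exists (x0, x0).
(* Compactness in near-covering form, for the filter of sufficiently small neighbourhoods [E] of the
   diagonal: only a local claim at each [v] remains. *)
have /compact_near_coveringP/(_ _ (powerset_filter_from (set_nbhs D))) := cX.
move=> /(_ (fun E v => forall v1 v2 v3, E (v, v1) -> E (v1, v2) ->
  E (v, v3) -> P v2 v3) _) [].
  move=> v _; have [[B1 B2] /= [vB1 vB2] BP] := nP v.
  have vB : nbhs v (B1 `&` B2) by exact: filterI.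
  (* Two nested shrinkings: from [C'] the first move stays in [C], and from there the second stays
     in both [B1] and [B2]. *)
  have [C [vC CB EC]] := shrink _ _ vB.
  have [C' [vC' _ EC']] := shrink _ _ vC.
  exists (C', [set E | set_nbhs D E /\
    E `<=` [set y | closure C y.1 -> (B1 `&` B2) y.2] `&`
           [set y | closure C' y.1 -> C y.2]]).
    by split => //; apply: powerset_filter_fromP;
      exact: (@filterI _ (set_nbhs D)).
  move=> [u E]/= [uC' [_ sE]] v1 v2 v3 /sE [_/= /(_ (subset_closure uC')) Cv1].
  move=> /sE [/= /(_ (subset_closure Cv1)) [B1v2 _] _].
  move=> /sE [_/= /(_ (subset_closure uC')) /CB [_ B2v3]].
  exact: (BP (v2, v3)).
move=> M [MF _ [E ME]] /(_ E ME) H; exists E; first exact/DE/MF.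
by move=> v v1 v2 v3; exact: (H v I).
Qed.
End near_diagonal.

Lemma cvg_addM {T : Type} {F : set_system T} {FF : Filter F}
    {M : topologicalZmodType} (f g : T -> M) (a b : M) :
  f x @[x --> F] --> a -> g x @[x --> F] --> b ->
  f x + g x @[x --> F] --> a + b.
Proof.
by move=> fa gb; exact:
  (continuous2_cvg FF (h := fun x y => x + y) (add_continuous (a, b)) fa gb).
Qed.

Lemma cvg_addr0 {M : topologicalZmodType} (a : M) :
  a + u @[u --> (0 : M)] --> a.
Proof.
by rewrite -[X in _ --> X]addr0; apply: cvg_addM;
  [exact: cvg_cst|exact: cvg_id].
Qed.

Lemma cvg_mulrn0 {M : topologicalZmodType} m :
  u *+ m @[u --> (0 : M)] --> (0 : M).
Proof.
elim: m => [|m IHm].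
  by rewrite [X in X @ _](_ : _ = cst 0) //; exact: cvg_cst.
rewrite -[X in _ --> X]addr0.
rewrite (_ : (fun u => u *+ m.+1) = fun u : M => u + u *+ m); last first.
  by apply/funext => u; rewrite mulrS.
by apply: cvg_addM => //; exact: cvg_id.
Qed.

Lemma cvg_subr0 {M : topologicalZmodType} (a : M) :
  b - a @[b --> a] --> (0 : M).
Proof.
by rewrite -(subrr a); apply: cvg_addM; [exact: cvg_id|exact: cvg_cst].
Qed.

Section local_translation.
Context {G : topologicalZmodType} {X : topologicalType} (p : X -> G).
Hypotheses (hX : hausdorff_space X) (cX : compact [set: X]).
Hypotheses (cp : continuous p)
  (p_open : forall v A, nbhs v A -> nbhs (p v) (p @` A))
  (p_inj : forall v : X, exists2 B, nbhs v B & {in B &, injective p}).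

(** [al v u] is the point over [p v + u] in the small sheet around [v]. The relation [E] makes small
    uniform in [v]: its chain property gives both uniqueness of the lift and composition of
    lifts. *)
Lemma local_translation : exists (O : set G) (al : X -> G -> X),
  [/\ nbhs (0 : G) O,
      forall v u, O u -> p (al v u) = p v + u,
      forall v u u', O u -> O u' -> O (u + u') ->
        al (al v u) u' = al v (u + u'),
      forall v, al v u @[u --> (0 : G)] --> v &
      forall v, \forall v' \near v, v' = al v (p v' - p v)].
Proof.
have [|E nE chain] := near_diagonal_chain hX cX
  (P := fun a b => p a = p b -> a = b).
  move=> v; have [B vB injB] := p_inj v; exists (B, B) => //= -[a b] [/= Ba Bb].
  by apply: injB; exact/mem_set.
have E0 v : E (v, v) by exact: (nbhs_singleton (nE v)).
have uniq v v2 v3 : E (v, v2) -> E (v, v3) -> p v2 = p v3 -> v2 = v3.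
  exact: chain (E0 v).
have lift v A : nbhs v A ->
    \forall u \near (0 : G), exists2 v', A v' & p v' = p v + u.
  by move=> /p_open; exact: cvg_addr0.
(* The translations that lift at all points of [X] at once; compactness makes them a neighbourhood
   of 0. *)
pose O := [set u : G | forall v, exists2 v', E (v, v') & p v' = p v + u].
have O0 : nbhs (0 : G) O.
  have /compact_near_coveringP/(_ _ (nbhs (0 : G))) := cX.
  move=> /(_ (fun u v => exists2 v', E (v, v') & p v' = p v + u)
    (nbhs_filter (0 : G))) nc.
  have : \forall u \near (0 : G), [set: X] `<=`
      (fun v => exists2 v', E (v, v') & p v' = p v + u).
    apply: nc.
    move=> v _; have [[A1 A2] /= [vA1 vA2] AE] := nE v.
    have : p x.1 + x.2 @[x --> ((v, 0) : X * G)] --> p v + 0.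
      apply: cvg_addM; last exact: cvg_snd.
      by apply: cvg_comp; [exact: cvg_fst|exact: cp].
    rewrite addr0 => /(_ _ (p_open vA2)) [[B1 B2] /= [vB1 vB2] BA].
    exists (A1 `&` B1, B2) => /=; first by split=> //; exact: filterI.
    move=> [x u] /= [[A1x B1x] B2u].
    have [v' A2v' pv'] := BA (x, u) (conj B1x B2u).
    by exists v' => //; exact: AE.
  by apply: filterS => u Ou v; exact: (Ou v I).
pose al v u := xget v [set v' | E (v, v') /\ p v' = p v + u].
have alE v v' u : E (v, v') -> p v' = p v + u -> al v u = v'.
  move=> Ev pv'; rewrite /al; case: xgetP => [y _ [Ey py]|/(_ v')];
    last by case.
  by apply: uniq Ey Ev _; rewrite py pv'.
have alP v u : O u -> E (v, al v u) /\ p (al v u) = p v + u.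
  by move=> /(_ v) [v' Ev' pv']; rewrite (alE _ _ _ Ev' pv').
exists O, al; split => //.
- by move=> v u /(alP v) [].
- move=> v u u' Ou Ou' Ouu'.
  have [E1 p1] := alP v _ Ou; have [E2 p2] := alP (al v u) _ Ou'.
  have [E3 p3] := alP v _ Ouu'.
  by apply: chain E1 E2 E3 _; rewrite p2 p1 p3 addrA.
- move=> v U vU; have [[A1 A2] /= [vA1 vA2] AE] := nE v.
  apply: filterS (lift v _ (filterI vU vA2)) => u [v' [Uv' A2v'] pv'] /=.
  by rewrite (alE _ _ _ _ pv') //; apply: AE; split=> //; exact: nbhs_singleton.
- move=> v; have [[A1 A2] /= [vA1 vA2] AE] := nE v.
  apply: filterS vA2 => v' A2v'; apply/esym/alE; last by rewrite addrC subrK.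
  by apply: AE; split=> //; exact: nbhs_singleton.
Qed.

End local_translation.

(** * Finite coverings *)

Lemma filter_bigcap_finite {T : Type} {F : set_system T} {FF : Filter F}
    {I : choiceType} (D : set I) (A : I -> set T) :
  finite_set D -> (forall i, D i -> F (A i)) -> F (\bigcap_(i in D) A i).
Proof.
move=> /finite_fsetP [E ->] FA; apply: filter_bigI => i iE; exact: FA.
Qed.

Lemma fmap_ultra {T U : Type} (f : T -> U) (F : set_system T) :
  UltraFilter F -> UltraFilter (f @ F).
Proof.
move=> UF; split=> [|G PG FG]; first exact: fmap_proper_filter.
apply/seteqP; split=> // A GA; apply: contrapT => nFA.
have [//|nA] := in_ultra_setVsetC (f @^-1` A) UF.
by have [y []] := filter_ex (filterI GA (FG (~` A) nA)).
Qed.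

Section covering.
Context {X B : topologicalType} (p : X -> B).

(** Turns the homeomorphisms between subspaces into properties of [p] on subsets, so that the
    arguments on coverings avoid subtypes. *)
Lemma evenly_covered_sheets (U : set B) : open U -> evenly_covered p U ->
  exists F : set (set X), [/\ trivIset F id, p @^-1` U = \bigcup_(V in F) V &
    forall V, F V -> [/\ open V, {in V &, injective p}, p @` V = U &
      forall A, open A -> A `<=` V -> open (p @` A)]].
Proof.
move=> oU [F [tF pU sF]]; exists F; split=> // V FV.
have [oV [f [[_ [g [cg fK gK]]] fpV]]] := sF V FV.
have fp (v : V) : val (f v) = p (val v) by have := fpV v; rewrite !set_valE.
split=> //.
- move=> a b Va Vb pab.
  have : f (exist _ a Va) = f (exist _ b Vb) by apply: val_inj; rewrite !fp.
  by move=> /(can_inj fK) [].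
- apply/seteqP; split=> [_ [v Vv <-]|u Uu].
    by have := set_valP (f (exist _ v (mem_set Vv))); rewrite fp.
  exists (val (g (exist _ u (mem_set Uu)))); first exact: set_valP.
  by rewrite -fp gK.
- move=> A oA AV.
  have : open (g @^-1` (val @^-1` A)).
    by apply: open_comp => [? _|]; [exact: cg|exists A].
  (* An open subset of the subspace [U] is the trace of some open [W], and [U] is itself open. *)
  move=> [W oW WA]; suff -> : p @` A = U `&` W by exact: openI.
  have memW (u : U) : W (val u) <-> A (val (g u)).
    by have /(congr1 (fun S : set U => S u)) /= -> := WA.
  apply/seteqP; split=> [_ [v Av <-]|u [Uu Wu]].
    have fvE := fp (exist _ v (mem_set (AV _ Av))).
    rewrite -[p v]fvE; split; first exact: set_valP.
    by apply/memW; rewrite fK.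
  exists (val (g (exist _ u (mem_set Uu)))); last by rewrite -fp gK.
  exact: (memW (exist _ u (mem_set Uu))).1.
Qed.

Hypothesis covp : covering_map p.

Lemma covering_sheet v : exists V, [/\ open V, V v, {in V &, injective p} &
  forall A, open A -> A `<=` V -> open (p @` A)].
Proof.
have [_ /(_ (p v)) [U [[oU Upv] /(evenly_covered_sheets oU) [F [_ pU sF]]]]]
  := covp.
have : (p @^-1` U) v by [].
rewrite pU => -[V FV Vv]; exists V.
by have [oV injV _ openV] := sF V FV; split.
Qed.

Lemma covering_map_open v A : nbhs v A -> nbhs (p v) (p @` A).
Proof.
have [V [oV Vv _ openV]] := covering_sheet v.
move=> /nbhs_interior vA; rewrite nbhsE; exists (p @` (A° `&` V)).
  split; last by exists v => //; split=> //; exact: nbhs_singleton.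
  by apply: openV => [|? []//]; apply: openI => //; exact: open_interior.
by move=> _ [y [/interior_subset Ay _] <-]; exists y.
Qed.

Lemma covering_map_locally_injective (v : X) :
  exists2 V : set X, nbhs (v : X) V & {in V &, injective p}.
Proof.
have [V [oV Vv injV _]] := covering_sheet v.
by exists V => //; exact: open_nbhs_nbhs.
Qed.

(** Points that cannot be separated have the same image, and the sheets through them meet, hence
    coincide; [p] is injective on that sheet. *)
Lemma covering_map_hausdorff : hausdorff_space B -> hausdorff_space X.
Proof.
have [cp ev] := covp.
move=> hB v v' vv'; have pvv' : p v = p v'.
  apply: hB => A A' /cp pA /cp pA'.
  by have [y []] := vv' _ _ pA pA'; exists (p y).
have [U [[oU Upv] /(evenly_covered_sheets oU) [F [tF pU sF]]]] := ev (p v).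
have : (p @^-1` U) v by [].
have : (p @^-1` U) v' by rewrite /= -pvv'.
rewrite pU => -[V' FV' V'v'] [V FV Vv].
have [oV injV _ _] := sF V FV; have [oV' _ _ _] := sF V' FV'.
have VV' : V = V'.
  apply: tF => //; apply: vv'; exact: open_nbhs_nbhs.
by apply: injV => //; apply/mem_set => //; rewrite VV'.
Qed.

(** The image of an ultrafilter [F] converges to some [b]. If [F] converged to no point over [b], it
    would avoid a neighbourhood of each of these finitely many points, yet such neighbourhoods cover
    everything above some neighbourhood of [b]. *)
Lemma finite_covering_compact : (forall b, finite_set (p @^-1` [set b])) ->
  compact [set: B] -> compact [set: X].
Proof.
move=> fin cB; have [cp ev] := covp; rewrite compact_ultra => F UF _.
have [b [_ Fb]] : [set: B] `&` cluster (p @ F) !=set0 by exact: cB filterT.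
have [U [[oU Ub] /(evenly_covered_sheets oU) [S [tS pU sS]]]] := ev b.
have pFU := fmap_ultra p UF.
have {}Fb : p @ F --> b by move: Fb; rewrite ultra_cvg_clusterE.
apply: contrapT => nF.
have bad v : exists A, open A /\ (A v /\ F (~` A)).
  have /existsNP [A' /not_implyP [/nbhs_interior A'v nFA']] : ~ F --> v.
    by move=> Fv; apply: nF; exists v.
  exists A'°; split; first exact: open_interior.
  split; first exact: nbhs_singleton.
  have [/(filterS (@interior_subset _ _))|//] := in_ultra_setVsetC A'° UF.
  by move=> /nFA'.
have [A Aok] := choice bad.
pose D := p @^-1` [set b].
have {}bad : F (\bigcap_(v in D) ~` A v).
  by apply: filter_bigcap_finite (fin b) _ => v _; have [_ []] := Aok v.
have /choice [T Tok] : forall v, exists V, D v -> S V /\ V v.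
  move=> v; have [Dv|] := pselect (D v); last by exists set0.
  have : (p @^-1` U) v by rewrite /= Dv.
  by rewrite pU => -[V SV Vv]; exists V.
have nW : F (p @^-1` (U `&` \bigcap_(v in D) (p @` (A v `&` T v)))).
  apply: Fb; apply: filterI; first exact: open_nbhs_nbhs.
  apply: filter_bigcap_finite (fin b) _ => v Dv.
  have [oA [Av _]] := Aok v; have [ST Tv] := Tok v Dv.
  have [oT _ _ openT] := sS _ ST.
  apply: open_nbhs_nbhs; split; last by exists v.
  by apply: openT => [|? []//]; exact: openI.
(* The sheet of [y] contains a point [v] over [b], so it is the chosen sheet [T v]; injectivity of
   [p] there puts [y] in [A v]. *)
have [y [By /= [Uy Wy]]] := filter_ex (filterI bad nW).
have : (p @^-1` U) y by [].
rewrite pU => -[V SV Vy]; have [oV injV pV _] := sS V SV.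
have : (p @` V) b by rewrite pV.
move=> [v Vv pv]; have [STv Tvv] := Tok v pv.
have [a [Aa Ta] pa] := Wy v pv.
apply: (By v pv); suff <- : a = y by [].
have TV : T v = V by apply: tS => //; exists v.
by rewrite TV in Ta; apply: injV => //; exact/mem_set.
Qed.
End covering.

(** * The solenoid as a topological group *)

(* An alias of the solenoid, so that its group structure, the product of
   coordinates written additively, does not attach to arbitrary subtypes. *)
Definition Solenoid (R : realType) (w : nat -> nat) : Type := solenoid R w.
HB.instance Definition _ (R : realType) (w : nat -> nat) :=
  Topological.copy (Solenoid R w) (set_type (solenoid R w)).

Section solenoid_group.
Context {R : realType} {w : nat -> nat}.
Local Notation Theta := (Solenoid R w).

(** Values are taken in the complex numbers rather than in the circle, so that field operations and
    limits apply directly. *)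
Definition coord (m : nat) (y : Theta) : R[i]^o :=
  val (val (y : solenoid R w) m).

Lemma coord_norm m (y : Theta) : `|coord m y| = 1.
Proof. exact: (set_valP (val (y : solenoid R w) m)). Qed.

Lemma coord_neq0 m (y : Theta) : coord m y != 0.
Proof. by rewrite -normr_eq0 coord_norm oner_eq0. Qed.

Lemma coordS m (y : Theta) : coord m y = coord m.+1 y ^+ w m.+1.
Proof.
have := congr1 (fun z : circle R => val z : R[i]^o)
  (set_valP (y : solenoid R w) m.+1 isT).
by rewrite /= set_valE.
Qed.

Lemma coord_inj (y z : Theta) : (forall m, coord m y = coord m z) -> y = z.
Proof. by move=> yz; apply/val_inj/funext => m; apply/val_inj/yz. Qed.

Section mk_solenoid.
Variables (z : nat -> R[i]^o) (z_norm : forall n, `|z n| = 1)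
  (zS : forall n, z n = z n.+1 ^+ w n.+1).

Definition pre_solenoid : {ptws nat -> circle R} :=
  fun n => exist _ (z n) (mem_set (z_norm n)).

Lemma pre_solenoidP : pre_solenoid \in solenoid R w.
Proof. by apply/mem_set => -[//|n] _; apply/val_inj; exact: zS. Qed.

Definition mk_solenoid : Theta := exist _ pre_solenoid pre_solenoidP.

Lemma coord_mk m : coord m mk_solenoid = z m.
Proof. by []. Qed.

End mk_solenoid.

Lemma solenoid0_norm (n : nat) : `|1 : R[i]^o| = 1.
Proof. exact: normr1. Qed.

Lemma solenoid0_coordS (n : nat) : (1 : R[i]^o) = 1 ^+ w n.+1.
Proof. by rewrite expr1n. Qed.

Definition solenoid0 : Theta := mk_solenoid solenoid0_norm solenoid0_coordS.

Lemma solenoidD_norm (y z : Theta) n : `|coord n y * coord n z| = 1.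
Proof. by rewrite normrM !coord_norm mulr1. Qed.

Lemma solenoidD_coordS (y z : Theta) n :
  coord n y * coord n z = (coord n.+1 y * coord n.+1 z) ^+ w n.+1.
Proof. by rewrite exprMn -!coordS. Qed.

Definition solenoidD (y z : Theta) : Theta :=
  mk_solenoid (solenoidD_norm y z) (solenoidD_coordS y z).

Lemma solenoidN_norm (y : Theta) n : `|(coord n y)^-1| = 1.
Proof. by rewrite normfV coord_norm invr1. Qed.

Lemma solenoidN_coordS (y : Theta) n :
  (coord n y)^-1 = (coord n.+1 y)^-1 ^+ w n.+1.
Proof. by rewrite exprVn -coordS. Qed.

Definition solenoidN (y : Theta) : Theta :=
  mk_solenoid (solenoidN_norm y) (solenoidN_coordS y).

Lemma solenoidDA : associative solenoidD.
Proof. by move=> x y z; apply: coord_inj => m; rewrite !coord_mk mulrA. Qed.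

Lemma solenoidDC : commutative solenoidD.
Proof. by move=> x y; apply: coord_inj => m; rewrite !coord_mk mulrC. Qed.

Lemma solenoidD0 : left_id solenoid0 solenoidD.
Proof. by move=> x; apply: coord_inj => m; rewrite !coord_mk mul1r. Qed.

Lemma solenoidDN : left_inverse solenoid0 solenoidN solenoidD.
Proof.
by move=> x; apply: coord_inj => m; rewrite !coord_mk mulVf ?coord_neq0.
Qed.

End solenoid_group.

HB.instance Definition _ (R : realType) (w : nat -> nat) :=
  GRing.isZmodule.Build (Solenoid R w)
    solenoidDA solenoidDC solenoidD0 solenoidDN.

Section solenoid_topology.
Context {R : realType} {w : nat -> nat}.
Local Notation Theta := (Solenoid R w).

Lemma coord0 m : coord m (0 : Theta) = 1. Proof. by []. Qed.

Lemma coordD m (y z : Theta) : coord m (y + z) = coord m y * coord m z.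
Proof. by []. Qed.

Lemma coordN m (y : Theta) : coord m (- y) = (coord m y)^-1.
Proof. by []. Qed.

Lemma coordMn m (y : Theta) n : coord m (y *+ n) = coord m y ^+ n.
Proof.
by elim: n => [|n IHn]; rewrite ?mulr0n ?coord0// mulrS coordD IHn exprS.
Qed.

Lemma initial_cvgP {S : choiceType} {T : topologicalType} (f : S -> T)
    (F : set_system S) (s : S) : Filter F ->
  f x @[x --> F] --> f s -> F --> (s : initial_topology f).
Proof.
move=> FF Ff A /= [B [[C oC <-] Cs] BA]; apply: (filterS BA).
by apply: Ff; exact: open_nbhs_nbhs.
Qed.

(** The topology is a nest of initial ones, from the subset, the product and the circle in turn. *)
Lemma coord_cvg (F : set_system Theta) (y : Theta) : Filter F ->
  (forall m, coord m x @[x --> F] --> coord m y) -> F --> y.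
Proof.
move=> FF Fy; apply: initial_cvgP; apply/cvg_sup => m; apply: initial_cvgP.
by apply: initial_cvgP; exact: Fy.
Qed.

Lemma coord_continuous m : continuous (coord m : Theta -> R[i]^o).
Proof.
move=> y.
apply: (@continuous_comp _ (circle R) _ (fun z : Theta => set_val z m) set_val);
  last exact: initial_continuous.
apply: (@continuous_comp _ {ptws nat -> circle R} _ set_val (fun z => z m));
  first exact: initial_continuous.
exact: proj_continuous.
Qed.

Lemma solenoid_sub_continuous : continuous (fun x : Theta * Theta => x.1 - x.2).
Proof.
move=> -[y z]; apply: coord_cvg => m /=; rewrite coordD coordN.
have h1 : coord m x.1 @[x --> (y, z)] --> coord m y.
  by apply: cvg_comp; [exact: cvg_fst|exact: coord_continuous].
have h2 : coord m x.2 @[x --> (y, z)] --> coord m z.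
  by apply: cvg_comp; [exact: cvg_snd|exact: coord_continuous].
exact: cvgM h1 (cvgV (coord_neq0 m z) h2).
Qed.

End solenoid_topology.

HB.instance Definition _ (R : realType) (w : nat -> nat) :=
  PreTopologicalNmodule_isTopologicalZmodule.Build (Solenoid R w)
    solenoid_sub_continuous.

(** * The circle *)

Section circle_exponential.
Context {R : realType}.
Implicit Types (s t : R) (z : R[i]^o).

(** This is [e^(2 pi i t)], normalised so that its kernel is the group of integers. *)
Definition cis t : R[i]^o :=
  (cos (t * (pi *+ 2)) +i* sin (t * (pi *+ 2)))%C.

Lemma cis_norm t : `|cis t| = 1.
Proof. by rewrite [LHS]normc_def /= cos2Dsin2 sqrtr1. Qed.

Lemma cis0 : cis 0 = 1.
Proof. by rewrite /cis mul0r cos0 sin0. Qed.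

Lemma cisD s t : cis (s + t) = cis s * cis t.
Proof.
rewrite /cis mulrDl cosD sinD; apply/eqP; rewrite eq_complex /=.
by rewrite eqxx addrC [X in X + _]mulrC [X in _ + X]mulrC eqxx.
Qed.

Lemma cisMn t n : cis (t *+ n) = cis t ^+ n.
Proof.
by elim: n => [|n IHn]; rewrite ?mulr0n ?cis0// mulrS cisD IHn exprS.
Qed.

Lemma cis_neq0 t : cis t != 0.
Proof. by rewrite -normr_eq0 cis_norm oner_eq0. Qed.

Lemma cisN t : cis (- t) = (cis t)^-1.
Proof.
by apply: (mulfI (cis_neq0 t)); rewrite -cisD subrr cis0 divff// cis_neq0.
Qed.

Lemma real_complex_continuous : continuous (fun t => t%:C%C : R[i]^o).
Proof.
move=> t; apply/cvgrPdist_lt => -[e e'] /=; rewrite ltcE /= => /andP[/eqP-> e0].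
apply: filterS (nbhsx_ballx t e e0) => s tse;
  rewrite -(raddfB (real_complex R)) normc_def /=.
by rewrite expr0n addr0 sqrtr_sqr ltcE /= eqxx.
Qed.

Lemma cis_continuous : continuous cis.
Proof.
move=> t.
have h (f : R -> R) : continuous f ->
    (f (s * (pi *+ 2)))%:C%C @[s --> t] --> ((f (t * (pi *+ 2)))%:C%C : R[i]^o).
  move=> cf; apply: (@continuous_comp _ _ _ (fun s => f (s * (pi *+ 2)))
    (fun s => s%:C%C : R[i]^o)); last exact: real_complex_continuous.
  by apply: continuous_comp; [exact: mulrr_continuous|exact: cf].
have cisE s : cis s = (cos (s * (pi *+ 2)))%:C%C +
    'i%C * (sin (s * (pi *+ 2)))%:C%C by exact: (complexE (cis s)).
rewrite /continuous_at cisE (_ : cis = fun s => (cos (s * (pi *+ 2)))%:C%C +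
  'i%C * (sin (s * (pi *+ 2)))%:C%C); last exact/funext.
by apply: cvgD; [|apply: cvgMl_tmp]; apply: h;
  [exact: continuous_cos|exact: continuous_sin].
Qed.

Lemma cis1 : cis 1 = 1.
Proof. by rewrite /cis mul1r cos2pi sin2pi. Qed.

Lemma cis_int (j : int) : cis j%:~R = 1.
Proof.
by case: j => n; rewrite ?NegzE ?mulrNz ?cisN -pmulrn cisMn cis1 expr1n ?invr1.
Qed.

(** Subtract the integer part. If the rest [s] were positive, then [sin (s * pi)] would be positive,
    whereas [cos (s * (pi *+ 2)) = 1] forces it to vanish. *)
Lemma cis_eq1 t : cis t = 1 -> exists j : int, t = j%:~R.
Proof.
move=> t1; exists (Num.floor t); apply/eqP; rewrite -subr_eq0; set s := _ - _.
have s1 : cis s = 1 by rewrite cisD cisN cis_int t1 mul1r invr1.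
have s0 : 0 <= s by rewrite subr_ge0 floor_le.
have s_lt1 : s < 1 by rewrite ltrBlDl -intrD1 lt_succ_floor.
rewrite eq_le s0 andbT leNgt; apply/negP => s_gt0.
have : 0 < sin (s * pi).
  by rewrite sin_gt0_pi// mulr_gt0 ?pi_gt0//= gtr_pMl ?pi_gt0.
have [+ _] : cos (s * (pi *+ 2)) = 1 /\ sin (s * (pi *+ 2)) = 0 by case: s1.
rewrite mulrnAr cos_mulr2n cos2sin2 mulr2n => h.
have /eqP : sin (s * pi) ^+ 2 = 0 by lra.
by rewrite sqrf_eq0 => /eqP ->; rewrite ltxx.
Qed.

(** The arccosine of the real part gives [t] up to sign, and its range [[0, pi]] gives the bound.
    The bound confines [t] to a compact interval, as the next two lemmas require. *)
Lemma cis_surj z : `|z| = 1 -> exists2 t, `|t| <= 2^-1 & z = cis t.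
Proof.
case: z => a b; rewrite normc_def /= => -[] /(congr1 (fun x => x ^+ 2)).
rewrite sqr_sqrtr ?addr_ge0 ?sqr_ge0// expr1n => ab.
have a1 : -1 <= a <= 1.
  by rewrite -ler_norml -(@ler_pXn2r _ 2)// ?nnegrE// -normrX ger0_norm
    ?sqr_ge0// expr1n -ab lerDl sqr_ge0.
pose t := acos a / (pi *+ 2).
have pi2_gt0 : 0 < pi *+ 2 :> R by rewrite pmulrn_lgt0 ?pi_gt0.
have pi2 : pi *+ 2 != 0 :> R by rewrite gt_eqF.
have t0 : 0 <= t by apply: divr_ge0; [exact: acos_ge0|exact: ltW].
have t1 : `|t| <= 2^-1.
  rewrite ger0_norm// ler_pdivrMr//.
  by rewrite -[pi *+ 2]mulr_natr mulrCA mulVf ?pnatr_eq0// mulr1 acos_lepi.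
have cosE : cos (t * (pi *+ 2)) = a by rewrite divfK// acosK.
have sinE : `|sin (t * (pi *+ 2))| = `|b|.
  by rewrite -!sqrtr_sqr sin2cos2 cosE -ab addrAC subrr add0r.
have [bs|bs] : b = sin (t * (pi *+ 2)) \/ b = - sin (t * (pi *+ 2)).
  by move/eqP: sinE; rewrite eqr_norm2 => /orP[] /eqP ->; rewrite ?opprK; auto.
- by exists t => //; rewrite /cis cosE -bs.
- by exists (- t); rewrite ?normrN// /cis mulNr cosN sinN cosE -bs.
Qed.

Lemma circle_compact : compact (circle R).
Proof.
rewrite (_ : circle R = cis @` `[- 2^-1, 2^-1]).
  apply: continuous_compact; last exact: segment_compact.
  exact/continuous_subspaceT/cis_continuous.
apply/seteqP; split=> [z /cis_surj [t t1 ->]|_ [t _ <-]]; last exact: cis_norm.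
by exists t => //=; rewrite in_itv /= -ler_norml.
Qed.

(** A local inverse of [cis] at 1: the parameters at distance at least [e] from 0 form the compact
    set [A], whose image is closed and misses 1. *)
Lemma near1_cis (e : R) : 0 < e ->
  \forall z \near (1 : R[i]^o), `|z| = 1 -> exists2 t, `|t| < e & z = cis t.
Proof.
move=> e0; pose A : set R := `[- 2^-1, - e] `|` `[e, 2^-1].
have AE t : A t <-> `|t| <= 2^-1 /\ e <= `|t|.
  rewrite /A /= !in_itv /=; have [t0|t0] := ler0P t; split.
  - by move=> [|] /andP[h1 h2]; split; lra.
  - by move=> [h1 h2]; left; apply/andP; split; lra.
  - by move=> [|] /andP[h1 h2]; split; lra.
  - by move=> [h1 h2]; right; apply/andP; split; lra.
have cA : compact (cis @` A).
  apply: continuous_compact; first exact/continuous_subspaceT/cis_continuous.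
  by apply: compactU; exact: segment_compact.
have : open_nbhs (1 : R[i]^o) (~` (cis @` A)).
  split; first exact/closed_openC/(compact_closed _ cA)/norm_hausdorff.
  move=> [t /AE [t_le et] /cis_eq1 [j tj]].
  have : `|t| < 1 by rewrite (le_lt_trans t_le)// invf_lt1// ltr1n.
  rewrite tj -intr_norm -[1]/(1%:~R) ltr_int => j1.
  have j0 : j = 0 by lia.
  by move: et; rewrite tj j0 normr0 leNgt e0.
move=> /open_nbhs_nbhs; apply: filterS => z nAz /cis_surj [t t_le zt].
exists t => //; rewrite ltNge; apply/negP => et; apply: nAz.
by exists t => //; apply/AE.
Qed.

End circle_exponential.

(** * The flow on the solenoid *)

Lemma cvg_exprn {K : numFieldType} {T : Type} {F : set_system T} {FF : Filter F}
    (f : T -> K) (a : K) n :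
  f x @[x --> F] --> a -> f x ^+ n @[x --> F] --> a ^+ n.
Proof.
move=> fa; elim: n => [|n IHn]; first by rewrite expr0; exact: cvg_cst.
rewrite exprS (_ : (fun x => f x ^+ n.+1) = f \* (fun x => f x ^+ n)).
  exact: cvgM fa IHn.
by apply/funext => x; rewrite exprS.
Qed.

Section flow.
Context {R : realType} {w : nat -> nat}.
Hypothesis w_gt1 : forall n, (0 < n)%N -> (1 < w n)%N.
Local Notation Theta := (Solenoid R w).
Implicit Types (s t : R) (y k : Theta).

Definition wprod n := (\prod_(i < n) w i.+1)%N.

Lemma wprodS n : wprod n.+1 = (wprod n * w n.+1)%N.
Proof. by rewrite /wprod big_ord_recr. Qed.

Lemma wprod_gt0 n : (0 < wprod n)%N.
Proof. by rewrite prodn_gt0// => i; rewrite ltnW// w_gt1. Qed.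

Lemma wprod_neq0 n : (wprod n)%:R != 0 :> R.
Proof. by rewrite pnatr_eq0 -lt0n wprod_gt0. Qed.

Lemma flow_norm t n : `|cis (t / (wprod n)%:R)| = 1.
Proof. exact: cis_norm. Qed.

Lemma flow_coordS t n :
  cis (t / (wprod n)%:R) = cis (t / (wprod n.+1)%:R) ^+ w n.+1.
Proof.
rewrite -cisMn wprodS natrM invfM; congr cis; rewrite -[RHS]mulr_natr.
by rewrite -!mulrA mulVf ?mulr1// pnatr_eq0 -lt0n ltnW// w_gt1.
Qed.

Definition flow t : Theta := mk_solenoid (flow_norm t) (flow_coordS t).

Lemma coord_flow n t : coord n (flow t) = cis (t / (wprod n)%:R).
Proof. by []. Qed.

Lemma flowD s t : flow (s + t) = flow s + flow t.
Proof.
by apply: coord_inj => m; rewrite coordD !coord_flow mulrDl cisD.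
Qed.

Lemma flow0 : flow 0 = 0.
Proof. by apply: coord_inj => m; rewrite coord_flow coord0 mul0r cis0. Qed.

Lemma flowN t : flow (- t) = - flow t.
Proof. by apply/eqP; rewrite -addr_eq0 -flowD addrC subrr flow0. Qed.

Lemma flowMn t n : flow (t *+ n) = flow t *+ n.
Proof. by elim: n => [|n IHn]; rewrite ?mulr0n ?flow0// !mulrS flowD IHn. Qed.

Lemma flow_continuous : continuous flow.
Proof.
move=> t; apply: coord_cvg => m.
apply: (@continuous_comp _ _ _ (fun t => t / (wprod m)%:R) cis).
  exact: mulrr_continuous.
exact: cis_continuous.
Qed.

(** This measures the ambiguity of the representation [flow t + k] with [k] in the kernel of the
    [n]-th coordinate. *)
Lemma flow_eq1 n t : coord n (flow t) = 1 ->
  exists j : int, t = j%:~R * (wprod n)%:R.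
Proof.
by move=> /cis_eq1 [j tj]; exists j; rewrite -tj divfK// wprod_neq0.
Qed.

Lemma coord_flow_wprod n j : coord n (flow (j * wprod n)%:R) = 1.
Proof.
by rewrite coord_flow natrM mulfK ?wprod_neq0// -[j%:R]/((j : int)%:~R) cis_int.
Qed.

Lemma coord_le1 m n y : (m <= n)%N -> coord n y = 1 -> coord m y = 1.
Proof.
move=> /subnK <-; elim: (n - m)%N => [|d IHd]//; rewrite addSn => yd.
by apply: IHd; rewrite coordS yd expr1n.
Qed.

(** The flow covers the circle of the [n]-th coordinate, so a suitable flow point can be
    subtracted. *)
Lemma flow_decomposition n y : exists t k, coord n k = 1 /\ y = flow t + k.
Proof.
have [t _ yt] := cis_surj (coord_norm n y).
exists (t * (wprod n)%:R), (y - flow (t * (wprod n)%:R)).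
split; last by rewrite addrC subrK.
by rewrite coordD coordN coord_flow mulfK ?wprod_neq0// yt divff ?cis_neq0.
Qed.

(** An arc of the flow times the kernel of a coordinate. The next two lemmas show that for positive
    [d] these sets form a base of neighbourhoods of 0. *)
Definition tube n (d : R) : set Theta :=
  [set y | exists s k, [/\ `|s| < d, coord n k = 1 & y = flow s + k]].

(** The tubes generate a filter, as the kernels decrease with [n]. It converges to 0 coordinatewise:
    in a tube of index [m] the [m]-th coordinate depends only on the short flow time. *)
Lemma nbhs0_tube (O : set Theta) : nbhs (0 : Theta) O ->
  exists n (d : R), 0 < d /\ tube n d `<=` O.
Proof.
pose D := [set nd : nat * R | 0 < nd.2].
pose F := filter_from D (fun nd => tube nd.1 nd.2).
have FF : Filter F.
  apply: filter_from_filter; first by exists (0%N, 1); exact: ltr01.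
  move=> [n d] [n' d'] /= d0 d0'; exists (maxn n n', Num.min d d').
    by rewrite /D /= lt_min d0.
  move=> y [s [k [+ kn ->]]]; rewrite lt_min => /andP[sd sd'].
  by split; exists s, k; split => //; apply: coord_le1 kn;
    [exact: leq_maxl|exact: leq_maxr].
have F0 : F --> (0 : Theta).
  apply: coord_cvg => m; rewrite coord0 => U U1.
  have : nbhs (0 : R) ((fun t => cis (t / (wprod m)%:R)) @^-1` U).
    have := @coord_continuous R w m (flow 0).
    rewrite /continuous_at coord_flow mul0r cis0 => /(_ _ U1) /flow_continuous.
    exact.
  move=> /nbhs_ballP [d d0 dU]; exists (m, d) => //= y [s [k [sd km ->]]].
  rewrite /= coordD km mulr1; by apply: dU; rewrite /ball /= sub0r normrN.
by move=> /F0 [[n d] d0 ndO]; exists n, d.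
Qed.

(** Only the [n]-th coordinate matters: near 1 it is [cis t] with small [t], and the flow at time
    [t * wprod n] realises it. *)
Lemma tube_nbhs n (d : R) : 0 < d -> nbhs (0 : Theta) (tube n d).
Proof.
move=> d0; have d'0 : 0 < d / (wprod n)%:R
  by rewrite divr_gt0// ltr0n wprod_gt0.
have := @coord_continuous R w n 0; rewrite /continuous_at coord0.
move=> /(_ _ (near1_cis d'0)) yn.
apply: (filterS (P := fun y : Theta => `|coord n y| = 1 ->
  exists2 t, `|t| < d / (wprod n)%:R & coord n y = cis t)) yn => y.
move=> /(_ (coord_norm n y)) [t td yt];
  exists (t * (wprod n)%:R), (y - flow (t * (wprod n)%:R)).
split; last by rewrite addrC subrK.
  by rewrite normrM normr_nat -ltr_pdivlMr// ltr0n wprod_gt0.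
rewrite coordD coordN coord_flow mulfK ?wprod_neq0// yt.
by rewrite divff ?cis_neq0.
Qed.

Lemma solenoid_hausdorff : hausdorff_space Theta.
Proof.
move=> y z yz; apply: coord_inj => m; apply: (@norm_hausdorff _ R[i]^o).
move=> A B /coord_continuous yA /coord_continuous zB.
by have [x []] := yz _ _ yA zB; exists (coord m x).
Qed.

(** The flow line is dense: a point [flow t + k] with [k] in the kernel of a late coordinate is
    close to [flow t]. *)
Lemma solenoid_connected : connected [set: Theta].
Proof.
rewrite (_ : [set: Theta] = closure (flow @` [set: R])).
  apply/connected_closure/connected_continuous_connected.
    by apply/connected_intervalP.
  exact/continuous_subspaceT/flow_continuous.
apply/seteqP; split=> // y _ U yU.
have : nbhs (0 : Theta) (fun u => U (y + u)).
  exact: (cvg_addr0 yU).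
move=> /nbhs0_tube [n [d [d0 dU]]].
have [t [k [kn yE]]] := flow_decomposition n y.
exists (flow t); split; first by exists t.
rewrite (_ : flow t = y - k); last by rewrite yE addrK.
apply: dU; exists 0, (- k); split; rewrite ?normr0 ?flow0 ?add0r//.
by rewrite coordN kn invr1.
Qed.

(** Along an ultrafilter each coordinate converges by compactness of the circle, and the relations
    between consecutive coordinates pass to the limits. *)
Lemma solenoid_compact : compact [set: Theta].
Proof.
rewrite compact_ultra => F UF _.
have cvgm m : exists z : R[i]^o, `|z| = 1 /\ coord m x @[x --> F] --> z.
  have mUF := fmap_ultra (coord m) UF.
  have [|z [z1]] := @circle_compact R _ (@ultra_proper _ _ mUF).
    apply: (@filterS _ F _ setT _ (fun x _ => coord_norm m x)).
    exact: filterT.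
  by rewrite (ultra_cvg_clusterE mUF) => zm; exists z.
have [z zP] := choice cvgm.
have z1 n : `|z n| = 1 by have [] := zP n.
have zS n : z n = z n.+1 ^+ w n.+1.
  have [_ zn] := zP n; have [_ zn1] := zP n.+1.
  apply: (cvg_unique (@norm_hausdorff _ R[i]^o) zn).
  rewrite /= (_ : coord n = fun x => coord n.+1 x ^+ w n.+1).
    exact: cvg_exprn.
  by apply/funext => x; rewrite -coordS.
exists (mk_solenoid z1 zS); split => //.
by apply: coord_cvg => m; have [] := zP m.
Qed.
End flow.

(** * Division in the kernel of a coordinate *)

Section roots.
Context {R : realType} {w : nat -> nat}.
Local Notation Theta := (Solenoid R w).
Variables (n D : nat).
Hypothesis D_coprime : forall m, (n <= m)%N -> coprime D (w m.+1).

Lemma expr_coprime_eq1 (K : fieldType) (z : K) a b :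
  coprime a b -> z ^+ a = 1 -> z ^+ b = 1 -> z = 1.
Proof.
have [->|a_gt0] := posnP a.
  by rewrite /coprime gcd0n => /eqP -> _; rewrite expr1.
move=> /eqP ab za zb; have [u v uv _] := egcdnP b a_gt0.
have := congr1 (fun e => z ^+ e) uv.
by rewrite /= exprD ab (mulnC u) (mulnC v) !exprM za zb !expr1n mul1r expr1.
Qed.

(** For [m >= n] this is the quotient of [wprod m] by [wprod n], otherwise 1. On the kernel of the
    [n]-th coordinate, the [m]-th coordinate is a root of unity of order dividing [e m]. *)
Let e m := (\prod_(n <= i < m) w i.+1)%N.

Let e_coprime m : coprime D (e m).
Proof.
rewrite /e big_nat; apply: (big_ind (coprime D)) => [|a b ha hb|i /andP[ni _]].
- exact: coprimen1.
- by rewrite coprimeMr ha.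
- exact: D_coprime.
Qed.

Let coord_expe m (k : Theta) : coord n k = 1 -> coord m k ^+ e m = 1.
Proof.
move=> kn; elim: m => [|m IHm].
  by rewrite /e big_geq// expr1 (coord_le1 _ kn).
have [nm|mn] := leqP n m.
  by rewrite /e big_nat_recr//= mulnC exprM -coordS.
by rewrite /e big_geq// expr1 (coord_le1 _ kn).
Qed.

(** Each coordinate is killed by the coprime exponents [D] and [e m]. *)
Lemma mulrn_kernel (k : Theta) : coord n k = 1 -> k *+ D = 0 -> k = 0.
Proof.
move=> kn kD; apply: coord_inj => m; apply: (expr_coprime_eq1 (e_coprime m)).
  by rewrite -coordMn kD coord0.
by rewrite (coord_expe _ kn).
Qed.

(** By Bezout [u m * D] is 1 modulo [e m], so the power [u m] is a [D]-th root in the [m]-th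
    coordinate. *)
Lemma mulrn_surj (k : Theta) : (0 < D)%N -> coord n k = 1 ->
  exists2 k', coord n k' = 1 & k' *+ D = k.
Proof.
move=> D_gt0 kn; pose u m := (egcdn D (e m)).1.
have rootD m : (coord m k ^+ u m) ^+ D = coord m k.
  rewrite -exprM /u; case: egcdnP => // a b ab _ /=.
  by rewrite ab exprD mulnC exprM coord_expe// expr1n mul1r (eqP (e_coprime
    m)) expr1.
have z_norm m : `|coord m k ^+ u m| = 1 by rewrite normrX coord_norm expr1n.
(* The roots are compatible because they are unique: the quotient of the two sides is killed by [D]
   and by [e m]. *)
have zS m : coord m k ^+ u m = (coord m.+1 k ^+ u m.+1) ^+ w m.+1.
  have k0 : coord m k ^+ u m != 0 by rewrite expf_neq0// coord_neq0.
  apply/esym/(mulIf (invr_neq0 k0)); rewrite divff//.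
  apply: (expr_coprime_eq1 (e_coprime m)).
    by rewrite exprMn exprVn rootD [_ ^+ w _ ^+ D]exprAC rootD -coordS divff//
      coord_neq0.
  rewrite exprAC -coordS exprMn exprVn -!exprM (mulnC (u m)) (mulnC (u m.+1)).
  by rewrite !exprM coord_expe// !expr1n invr1 mulr1.
exists (mk_solenoid z_norm zS); first by rewrite coord_mk kn expr1n.
by apply: coord_inj => m; rewrite coordMn coord_mk rootD.
Qed.

End roots.

(** * The global action *)

Lemma iter_comm {T : Type} (f g : T -> T) : (forall v, f (g v) = g (f v)) ->
  forall n v, iter n f (g v) = g (iter n f v).
Proof. by move=> fg; elim=> [//|n IHn] v; rewrite !iterS IHn fg. Qed.

Lemma iter_compose {T : Type} (f g : T -> T) :
  (forall v, f (g v) = g (f v)) ->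
  forall n v, iter n (g \o f) v = iter n g (iter n f v).
Proof.
move=> fg; elim=> [//|n IHn] v; rewrite !iterS IHn /=; congr g.
by rewrite -(@iter_comm _ g f).
Qed.

Lemma iter_mul {T : Type} (f : T ->
  T) m n v : iter (m * n) f v = iter m (iter n f) v.
Proof. by elim: m => [//|m IHm]; rewrite mulSn iterD IHm. Qed.

Section global_action.
Context {R : realType} {w : nat -> nat}.
Hypothesis w_gt1 : forall n, (0 < n)%N -> (1 < w n)%N.
Local Notation Theta := (Solenoid R w).
Local Notation flow := (flow w_gt1).
Local Notation tube := (tube w_gt1).
Context {X : topologicalType} (p : X -> Theta) (al : X -> Theta -> X).
Variables (n0 : nat) (d : R).
Hypothesis d_gt0 : 0 < d.
Hypothesis al_p : forall v u, tube n0 d u -> p (al v u) = p v + u.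
Hypothesis al_al : forall v u u', tube n0 d u -> tube n0 d u' ->
  tube n0 d (u + u') -> al (al v u) u' = al v (u + u').
Hypothesis al0 : forall v, al v 0 = v.
Implicit Types (s t : R) (k : Theta) (v : X).

Lemma tubeD s k : `|s| < d -> coord n0 k = 1 -> tube n0 d (flow s + k).
Proof. by exists s, k. Qed.

Lemma tube_flow s : `|s| < d -> tube n0 d (flow s).
Proof. by move=> sd; rewrite -[flow s]addr0; apply: tubeD. Qed.

Lemma tube_ker k : coord n0 k = 1 -> tube n0 d k.
Proof.
by move=> kn; rewrite -[k]add0r -(flow0 w_gt1); apply: tubeD; rewrite ?normr0.
Qed.

Definition step s v := al v (flow s).

Lemma step_comm s k v : `|s| < d -> coord n0 k = 1 ->
  step s (al v k) = al (step s v) k.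
Proof.
move=> sd kn; have [ts tk] := (tube_flow sd, tube_ker kn).
by rewrite /step !al_al ?[k + _]addrC//; exact: tubeD.
Qed.

Lemma step_step s t v : `|s| < d -> `|t| < d -> `|s + t| < d ->
  step t (step s v) = step (s + t) v.
Proof.
move=> sd td std; rewrite /step al_al ?flowD//; try exact: tube_flow.
by rewrite -flowD; exact: tube_flow.
Qed.

Lemma iter_step s m v : `|s| * m%:R < d -> iter m (step s) v = step (s *+ m) v.
Proof.
elim: m => [|m IHm] smd; first by rewrite mulr0n /step flow0 al0.
have le_m (i j : nat) : (i <= j)%N -> `|s| * i%:R <= `|s| * j%:R.
  by move=> ij; rewrite ler_wpM2l// ler_nat.
have normM (i : nat) : `|s *+ i| = `|s| * i%:R by rewrite normrMn mulr_natr.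
rewrite iterS IHm ?(le_lt_trans (le_m _ _ (leqnSn m)) smd)// mulrSr.
rewrite step_step// ?normM ?(le_lt_trans (le_m _ _ (leqnSn m)) smd)//.
  by apply: le_lt_trans smd; rewrite -[X in X <= _]mulr1 (le_m 1%N).
by rewrite -mulrSr normM.
Qed.

(* The flow lifted to [X]; by [betaE] any number of steps that are short enough
   gives the same result. *)
Definition beta t v :=
  let N := (Num.truncn (`|t| / d)).+1 in iter N (step (t / N%:R)) v.

(** Two admissible numbers of steps both agree with their product, since each step splits into equal
    shorter ones. *)
Lemma betaE t v M : `|t| < d * M%:R -> beta t v = iter M (step (t / M%:R)) v.
Proof.
have refine (N L : nat) : (0 < N)%N -> (0 < L)%N -> `|t| < d * N%:R ->
    iter N (step (t / N%:R)) v = iter (N * L) (step (t / (N * L)%:R)) v.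
  move=> N0 L0 tN; have [N0' L0'] : N%:R != 0 :> R /\ L%:R != 0 :> R.
    by rewrite !pnatr_eq0 -!lt0n.
  rewrite iter_mul; apply: eq_iter => u; rewrite iter_step.
    by rewrite -[_ *+ L]mulr_natr natrM invfM mulrA divfK.
  rewrite normrM normfV natrM normrM !normr_nat invfM mulrA divfK//.
  by rewrite ltr_pdivrMr// ltr0n.
move=> tM; have M0 : (0 < M)%N.
  by case: (M) tM => //; rewrite mulr0 normr_lt0.
rewrite /beta; set N := (_.+1); have tN : `|t| < d * N%:R.
  by rewrite mulrC -ltr_pdivrMr// truncnS_gt.
by rewrite (refine N M)// (refine M N)// mulnC.
Qed.

Lemma beta_common s t : exists M : nat, [/\ (0 < M)%N, `|s| < d * M%:R,
  `|t| < d * M%:R & `|s + t| < d * M%:R].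
Proof.
exists (Num.truncn ((`|s| + `|t|) / d)).+1.
have h : `|s| + `|t| < d * (Num.truncn ((`|s| + `|t|) / d)).+1%:R.
  by rewrite mulrC -ltr_pdivrMr// truncnS_gt.
split=> //; apply: le_lt_trans h; rewrite ?lerDl ?lerDr//; exact: ler_normD.
Qed.

Lemma small_div t (M : nat) : (0 < M)%N -> `|t| < d * M%:R -> `|t / M%:R| < d.
Proof. by move=> M0 tM; rewrite normrM normfV normr_nat ltr_pdivrMr// ltr0n.
  Qed.

(** With one number of steps for [s], [t] and [s + t], the short steps commute, so the combined
    iterate separates. *)
Lemma betaD s t v : beta (s + t) v = beta t (beta s v).
Proof.
have [M [M0 sM tM stM]] := beta_common s t.
rewrite !(betaE _ sM) (betaE _ tM) (betaE _ stM).
have sd := small_div M0 sM; have td := small_div M0 tM.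
have std := small_div M0 stM; rewrite mulrDl in std *.
rewrite -iter_compose// => [|u]; last by rewrite !step_step// 1?addrC.
by apply: eq_iter => u; rewrite /= step_step.
Qed.

Lemma beta_small s v : `|s| < d -> beta s v = step s v.
Proof. by move=> sd; rewrite (@betaE _ _ 1%N) ?mulr1//= divr1. Qed.

Lemma beta_al t k v : coord n0 k = 1 -> beta t (al v k) = al (beta t v) k.
Proof.
move=> kn; have [M [M0 tM _ _]] := beta_common t 0.
rewrite !(betaE _ tM) (@iter_comm _ _ (al^~ k))// => u.
by apply: step_comm => //; exact: small_div.
Qed.

Lemma p_beta t v : p (beta t v) = p v + flow t.
Proof.
have [M [M0 tM _ _]] := beta_common t 0; rewrite (betaE _ tM).
have -> : flow t = flow (t / M%:R) *+ M.
  by rewrite -flowMn -[_ *+ M]mulr_natr divfK// pnatr_eq0 -lt0n.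
have ts := tube_flow (small_div M0 tM).
move: (t / _) ts => s ts; elim: (M) => [|m IHm]; first by rewrite mulr0n addr0.
by rewrite iterS al_p// IHm mulrSr addrA.
Qed.

(** The kernel part needs no subdivision, as the kernel lies inside the tube where [al] is
    additive. *)
Definition act t k v := al (beta t v) k.

Lemma p_act t k v : coord n0 k = 1 -> p (act t k v) = p v + flow t + k.
Proof. by move=> kn; rewrite al_p ?p_beta//; exact: tube_ker. Qed.

Lemma act0 v : act 0 0 v = v.
Proof. by rewrite /act al0 beta_small ?normr0// /step flow0 al0. Qed.

Lemma actD s t k l v : coord n0 k = 1 -> coord n0 l = 1 ->
  act (s + t) (k + l) v = act t l (act s k v).
Proof.
move=> kn ln; rewrite /act betaD beta_al// al_al//; try exact: tube_ker.
by apply: tube_ker; rewrite coordD kn ln mulr1.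
Qed.

Lemma act_small s k v : `|s| < d -> coord n0 k = 1 ->
  act s k v = al v (flow s + k).
Proof.
move=> sd kn; rewrite /act beta_small// /step al_al//.
- exact: tube_flow.
- exact: tube_ker.
- exact: tubeD.
Qed.

Lemma act_inj t k v v' : coord n0 k = 1 -> act t k v = act t k v' -> v = v'.
Proof.
move=> kn /(congr1 (act (- t) (- k))).
by rewrite -!actD ?coordN ?kn ?invr1// !subrr !act0.
Qed.

(** * Periods and orbits *)

Hypothesis al_cvg : forall v, al v u @[u --> (0 : Theta)] --> v.
Hypothesis al_near : forall v, \forall v' \near v, v' = al v (p v' - p v).
Hypothesis p_cont : continuous p.
Hypothesis p_finite : forall b, finite_set (p @^-1` [set b]).
Local Notation W := (@wprod w).
Variable x : X.

(** The pairs [(t, - flow t)] with [flow t] in the kernel act along the fibres of [p]; the periods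
    describe the stabiliser of [x] among them. *)
Definition period t := coord n0 (flow t) = 1 /\ act t (- flow t) x = x.

Lemma coordN_eq1 n k : coord n k = 1 -> coord n (- k) = 1.
Proof. by move=> kn; rewrite coordN kn invr1. Qed.

Lemma coordD_eq1 n k k' : coord n k = 1 -> coord n k' = 1 ->
  coord n (k + k') = 1.
Proof. by move=> kn kn'; rewrite coordD kn kn' mulr1. Qed.

Lemma coordMn_eq1 n k m : coord n k = 1 -> coord n (k *+ m) = 1.
Proof. by move=> kn; rewrite coordMn kn expr1n. Qed.

Lemma period0 : period 0.
Proof. by rewrite /period flow0 oppr0 act0 coord0. Qed.

Lemma periodD s t : period s -> period t -> period (s + t).
Proof.
move=> [sn sx] [tn tx]; split; rewrite flowD; first exact: coordD_eq1.
by rewrite opprD actD ?sx//; exact: coordN_eq1.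
Qed.

Lemma periodN t : period t -> period (- t).
Proof.
move=> [tn tx]; split; rewrite flowN; first exact: coordN_eq1.
apply: (act_inj (t := t) (k := - flow t)); first exact: coordN_eq1.
by rewrite tx -actD ?opprK ?addNr ?subrr ?act0//; exact: coordN_eq1.
Qed.

Lemma periodMn t n : period t -> period (t *+ n).
Proof.
move=> pt; elim: n => [|n IHn]; first by rewrite mulr0n; exact: period0.
by rewrite mulrS; exact: periodD.
Qed.

Lemma periodMz t (j : int) : period t -> period (j%:~R * t).
Proof.
move=> pt; rewrite mulrzl; case: j => n; first exact: periodMn.
by rewrite NegzE mulrNz; apply: periodN; exact: periodMn.
Qed.

(** Pigeonhole: the points [f j] all lie in the finite fibre of [x], so two coincide, and the
    difference of their indices works. *)
Lemma exists_period : exists2 D, (0 < D)%N & period (D * W n0)%:R.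
Proof.
pose f (j : nat) := act (j * W n0)%:R (- flow (j * W n0)%:R) x.
have W1 j : coord n0 (flow (j * W n0)%:R : Theta) = 1
  by exact: coord_flow_wprod.
have pf j : p (f j) = p x.
  by rewrite p_act ?addrK//; exact: coordN_eq1.
have [i [j [ij fij]]] : exists i j, (i < j)%N /\ f i = f j.
  apply: contrapT => nf; have finj : injective f.
    move=> i j fij; apply: contrapT => /eqP; rewrite neq_ltn => /orP[ij|ij].
      by apply: nf; exists i, j.
    by apply: nf; exists j, i.
  apply: infinite_nat; have := finite_preimage (in2W finj) (p_finite (p x)).
  by apply: sub_finite_set => i _; exact: pf.
exists (j - i)%N; first by rewrite subn_gt0.
split; first exact: W1.
apply: (act_inj (t := (i * W n0)%:R) (k := - flow (i * W n0)%:R)).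
  exact: coordN_eq1.
by rewrite -actD -?opprD -?flowD -?natrD -?mulnDl ?subnK ?(ltnW ij) ?coordN_eq1.
Qed.

Lemma wprod_dvd m n : (m <= n)%N -> (W m %| W n)%N.
Proof.
move=> /subnK <-; elim: (n - m)%N => [|i IHi]; first exact: dvdnn.
by rewrite addSn wprodS dvdn_mulr.
Qed.

(* If g = gcd(D, w_(m+1)) > 1 for some m >= n, then c_(m+1)^(D/g) is a power of
   c_n^D, hence fixes [x]. *)
Lemma minimal_period : exists n D, [/\ (n0 <= n)%N, (0 < D)%N,
  forall m, (n <= m)%N -> coprime D (w m.+1) &
  forall j : int, period (j%:~R * (W n)%:R) <-> exists i : int, j = i * D%:Z].
Proof.
(* The minimum is taken over all levels [n >= n0] at once, so that it also bounds the periods at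
   later levels. *)
pose Q D := `[< (0 < D)%N /\ exists2 n, (n0 <= n)%N & period (D * W n)%:R >].
have exQ : exists D, Q D.
  have [D D0 pD] := exists_period; exists D; apply/asboolP; split => //.
  by exists n0.
case: (ex_minnP exQ) => D /asboolP[D0 [n n0n pD]] minD.
have {}minD m D' : (n0 <= m)%N -> (0 < D')%N -> period (D' * W m)%:R ->
  (D <= D')%N.
  by move=> n0m D'0 pD'; apply: minD; apply/asboolP; split => //; exists m.
exists n, D; split => //.
- move=> m nm; set g := gcdn D (w m.+1);
  have g0 : (0 < g)%N by rewrite gcdn_gt0 D0.
  rewrite /coprime -/g eqn_leq g0 andbT leqNgt; apply/negP => g1.
  have : (D <= D %/ g)%N.
    apply: (minD m.+1); first exact: leq_trans n0n (leqW nm).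
      by rewrite divn_gt0// dvdn_leq// dvdn_gcdl.
    have /dvdnP[a aE] := dvdn_gcdr D (w m.+1); rewrite -/g in aE.
    have /dvdnP[b bE] := wprod_dvd nm.
    rewrite (_ : (D %/ g * W m.+1 = D * W n * (b * a))%N).
      by rewrite natrM mulr_natr; exact: periodMn.
    rewrite wprodS aE bE -{2}(divnK (dvdn_gcdl D (w m.+1))) -/g.
    by move: (D %/ g)%N => q; lia.
  by rewrite leqNgt ltn_Pdiv.
(* Euclidean division: a nonzero remainder of [j] modulo [D] would give a smaller period at level
   [n]. *)
- move=> j; split=> [pj|[i ->]]; last first.
    by rewrite intrM -mulrA -natrM; exact: periodMz.
  exists (j %/ D)%Z; rewrite {1}(divz_eq j D).
  have D0' : (D : int) != 0 by rewrite eqz_nat -lt0n.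
  have := modz_ge0 j D0'; have := @ltz_pmod j D; rewrite ltz_nat => /(_ D0).
  have : period ((j %% D)%Z%:~R * (W n)%:R).
    rewrite (_ : _ * _ = j%:~R * (W n)%:R - (j %/ D)%Z%:~R * (D * W n)%:R).
      by apply: periodD => //; apply: periodN; exact: periodMz.
    have -> : j%:~R = (j %/ D)%Z%:~R * D%:R + (j %% D)%Z%:~R :> R.
      by rewrite {1}(divz_eq j D) intrD intrM.
    by rewrite natrM mulrDl mulrA addrAC subrr add0r.
  case: (j %% D)%Z => // -[|r] pr rD _; first by rewrite addr0.
  have : (D <= r.+1)%N by apply: (minD n) => //; rewrite natrM.
  by rewrite leqNgt -ltz_nat rD.
Qed.

(** * The orbit of [x] as an injective image of the solenoid *)

Variables (n D : nat).
Hypothesis n0n : (n0 <= n)%N.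
Hypothesis D_gt0 : (0 < D)%N.
Hypothesis D_coprime : forall m, (n <= m)%N -> coprime D (w m.+1).
Hypothesis periodP :
  forall j : int, period (j%:~R * (W n)%:R) <-> exists i : int, j = i * D%:Z.

Let coordn0 k : coord n k = 1 -> coord n0 k = 1.
Proof. exact: coord_le1. Qed.

Definition orbit := [set v | exists t k, coord n k = 1 /\ v = act t k x].

(** For [v'] near [v] the difference [p v' - p v] lies in a tube, where [al] and [act] agree. *)
Lemma orbit_near v : \forall v' \near v,
  exists s k, coord n k = 1 /\ v' = act s k v.
Proof.
have pvn : \forall v' \near v, tube n d (p v' - p v).
  have : p v' - p v @[v' --> v] --> p v - p v.
    by apply: cvg_addM; [exact: p_cont|exact: cvg_cst].
  by rewrite subrr; apply; exact: tube_nbhs.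
apply: filterS2 pvn (al_near v) => v' [s [k [sd kn pE]]] v'E.
by exists s, k; split => //; rewrite v'E pE act_small//; exact: coordn0.
Qed.

(** By [orbit_near] each point has a neighbourhood inside its own orbit, so the orbit of [x] and its
    complement are both open. *)
Lemma orbit_clopen : clopen orbit.
Proof.
split.
  rewrite openE => v [t [k [kn ->]]]; apply: filterS (orbit_near _) => v'.
  move=> [s [l [ln ->]]]; exists (t + s), (k + l).
  by split; [exact: coordD_eq1|rewrite actD//; exact: coordn0].
rewrite -openC openE => v nv; apply: filterS (orbit_near v) => v'.
move=> [s [l [ln v'E]]] [t [k [kn v'x]]]; apply: nv.
exists (t - s), (k - l); split; first by apply: coordD_eq1 => //;
  exact: coordN_eq1.
rewrite actD -?v'x ?v'E; [|exact: coordn0|exact/coordn0/coordN_eq1].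
rewrite -actD ?subrr ?act0//; [exact: coordn0|exact/coordn0/coordN_eq1].
Qed.

Lemma param_subproof y : exists tk : R * Theta,
  coord n tk.2 = 1 /\ y = flow tk.1 + tk.2.
Proof. by have [t [k h]] := flow_decomposition w_gt1 n y; exists (t, k). Qed.

(** The pair is chosen arbitrarily; [orbit_mapE] shows that the choice does not matter. *)
Definition orbit_map y :=
  let tk := sval (cid (param_subproof y)) in act (tk.1 *+ D) (tk.2 *+ D) x.

(** The times of two decompositions differ by a multiple of [wprod n], which becomes a period after
    multiplication by [D]. *)
Lemma orbit_mapE t k : coord n k = 1 ->
  orbit_map (flow t + k) = act (t *+ D) (k *+ D) x.
Proof.
move=> kn; rewrite /orbit_map; case: cid => -[t' k'] /= [k'n tkE].
have k'E : k' = k - flow (t' - t).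
  by rewrite flowD flowN opprB addrA (addrC k) tkE addrAC subrr add0r.
have : coord n (flow (t' - t)) = 1.
  rewrite (_ : flow _ = k - k'); last by rewrite k'E subKr.
  by apply: coordD_eq1 => //; exact: coordN_eq1.
move=> /flow_eq1 [j tj].
have [an ax] : period ((t' - t) *+ D).
  rewrite (_ : _ *+ D = (j * D)%:~R * (W n)%:R); first by apply/periodP;
    exists j.
  by rewrite tj intrM mulrAC -[_ *+ D]mulr_natr.
rewrite k'E mulrnBl -flowMn -[t' in t' *+ D](subrK t) mulrnDl.
rewrite [k *+ D - _]addrC actD ?ax//.
  by apply: coordN_eq1.
exact/coordn0/coordMn_eq1.
Qed.

Lemma p_orbit_map y : p (orbit_map y) = p x + y *+ D.
Proof.
have [t [k [kn ->]]] := flow_decomposition w_gt1 n y.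
rewrite orbit_mapE// p_act ?flowMn ?mulrnDl ?addrA//.
exact/coordn0/coordMn_eq1.
Qed.

(** The radius is divided by [D] because the flow time gets multiplied by [D]. This reduces
    continuity at [y] to that of [al] at 0. *)
Lemma orbit_mapD y u : tube n (d / D%:R) u ->
  orbit_map (y + u) = al (orbit_map y) (u *+ D).
Proof.
have [t [k [kn ->]]] := flow_decomposition w_gt1 n y.
move=> [s [l [sd ln ->]]]; rewrite addrACA -flowD !orbit_mapE ?coordD_eq1//.
rewrite !mulrnDl actD; try exact/coordn0/coordMn_eq1.
rewrite act_small ?flowMn//; last exact/coordn0/coordMn_eq1.
by rewrite normrMn -[_ *+ D]mulr_natr -ltr_pdivlMr// ltr0n.
Qed.

Lemma orbit_map_continuous : continuous orbit_map.
Proof.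
move=> y U Uy; have mulD : u *+ D @[u --> (0 : Theta)] --> (0 : Theta)
  by exact: cvg_mulrn0.
have Uu : nbhs (0 : Theta) (fun u => U (orbit_map (y + u))).
  have tn : nbhs (0 : Theta) (tube n (d / D%:R)).
    by apply: tube_nbhs; rewrite divr_gt0// ltr0n.
  by apply: filterS2 tn (mulD _ (al_cvg Uy)) => u tu /=; rewrite orbit_mapD.
have : y' - y @[y' --> y] --> (0 : Theta) by exact: cvg_subr0.
move=> /(_ _ Uu) yU.
apply: (filterS (P := fun y' => U (orbit_map (y + (y' - y))))) yU => y' /=.
by rewrite addrC subrK.
Qed.

(** Projecting by [p] shows that [D] kills [y - y']. Equality of the images also makes
    [(t - t') *+ D] a period, so by [periodP] the time [t - t'] is a multiple of [wprod n]. Then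
    [y - y'] lies in the kernel, where multiplication by [D] is injective. *)
Lemma orbit_map_inj : injective orbit_map.
Proof.
move=> y y'; have [t [k [kn ->]]] := flow_decomposition w_gt1 n y.
have [t' [k' [k'n ->]]] := flow_decomposition w_gt1 n y'.
move=> hE; have := congr1 p hE; rewrite !p_orbit_map => /addrI /eqP.
rewrite -subr_eq0 -mulrnBl opprD addrACA => /eqP.
rewrite -flowN -flowD => zD; apply/eqP; rewrite -subr_eq0 opprD addrACA.
rewrite -flowN -flowD; apply/eqP.
have kk'n : coord n (k - k') = 1 by apply: coordD_eq1 => //; exact: coordN_eq1.
have kk'D : (k - k') *+ D = - flow ((t - t') *+ D).
  by apply/eqP; rewrite -addr_eq0 addrC flowMn -mulrnDl zD.
have per : period ((t - t') *+ D).
  split; first by rewrite -[flow _]opprK -kk'D;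
    exact/coordn0/coordN_eq1/coordMn_eq1.
  apply: (act_inj (t := t' *+ D) (k := k' *+ D));
    first exact/coordn0/coordMn_eq1.
  rewrite -actD -?mulrnDl ?subrK -?kk'D -?mulrnDl ?subrK;
    try exact/coordn0/coordMn_eq1.
  by rewrite -!orbit_mapE.
have : coord n (flow ((t - t') *+ D)) = 1.
  by rewrite -[flow _]opprK -kk'D; exact/coordN_eq1/coordMn_eq1.
move=> /flow_eq1 [j tj]; move: (per); rewrite tj => /periodP [i ji].
have {}tj : t - t' = i%:~R * (W n)%:R.
  have D0 : D%:R != 0 :> R by rewrite pnatr_eq0 -lt0n.
  by apply: (mulIf D0); rewrite [LHS]mulr_natr tj ji intrM mulrAC.
apply: (mulrn_kernel D_coprime) => //; apply: coordD_eq1 => //.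
by rewrite tj coord_flow mulfK ?cis_int// wprod_neq0.
Qed.

(** Every point of the orbit is reached, since both the time and, by [mulrn_surj], the kernel
    element are divisible by [D]. *)
Lemma range_orbit_map : range orbit_map = orbit.
Proof.
apply/seteqP; split=> [_ [y _ <-]|_ [t [k [kn ->]]]].
  have [t [k [kn ->]]] := flow_decomposition w_gt1 n y.
  exists (t *+ D), (k *+ D); rewrite orbit_mapE//.
  by split => //; exact: coordMn_eq1.
have [k' k'n k'D] := mulrn_surj D_coprime D_gt0 kn.
exists (flow (t / D%:R) + k') => //; rewrite orbit_mapE// k'D.
by rewrite -[_ *+ D]mulr_natr divfK// pnatr_eq0 -lt0n.
Qed.

Lemma orbit_component : connected_component [set: X] x = orbit.
Proof.
have ox : orbit x by exists 0, 0; rewrite act0 coord0.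
apply/seteqP; split; last first.
  apply: connected_component_max => //; rewrite -range_orbit_map.
  apply: connected_continuous_connected; first exact: solenoid_connected.
  exact/continuous_subspaceT/orbit_map_continuous.
(* The orbit cuts the component in a nonempty clopen subset, hence in all of it. *)
have [oo co] := orbit_clopen.
have /(_ (connected_component setT x `&` orbit)) <- :=
  @component_connected X setT x.
- by move=> v [].
- by exists x; split => //; exact: connected_component_refl.
- by exists orbit.
- by exists orbit.
Qed.
End global_action.

(** * From a continuous injection to the homeomorphism *)

Lemma homeomorphic_range {S T : topologicalType} (h : S -> T) :
  compact [set: S] -> hausdorff_space T -> continuous h -> injective h ->
  homeomorphic (range h) S.
Proof.
move=> cS hT ch hI.
have hf (a : range h) : exists y, h y = val a.
  by have [y _ hy] := set_valP a; exists y.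
pose f (a : range h) := sval (cid (hf a)).
have fE a : h (f a) = val a by rewrite /f; case: cid.
pose g y : range h := exist _ (h y) (mem_set (imageT h y)).
exists f; split.
  (* The inverse is continuous because [h] is closed: a closed [A] in the compact [S] has a compact
     image, which is closed in the Hausdorff space [T]. *)
  apply/continuous_closedP => A cA.
  have -> : f @^-1` A = val @^-1` (h @` A).
    apply/seteqP; split=> a /=; first by move=> Af; exists (f a).
    by move=> [y Ay hy]; rewrite (_ : f a = y)//; apply: hI; rewrite fE hy.
  apply: preimage_closed => [? _|]; first exact: initial_continuous.
  apply: compact_closed => //; apply: continuous_compact.
    exact: continuous_subspaceT.
  exact: subclosed_compact cA cS _.
exists g; split.
- by move=> y; apply: initial_cvgP; exact: ch.
- by move=> a; apply: val_inj; rewrite /= fE.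
- by move=> y; apply: hI; rewrite fE.
Qed.

Theorem theorem2 (R : realType) (w : nat -> nat)
    (hw : forall n : nat, (0 < n)%N -> (1 < w n)%N)
    (r : nat) (hr : (1 <= r)%N) (X : topologicalType)
    (p : X -> solenoid R w) (hp : fold_covering r p) (x : X) :
  homeomorphic (connected_component [set: X] x) (solenoid R w).
Proof.
have [cov p_fib] : @fold_covering r X (Solenoid R w) p := hp.
(* The same map, with its codomain seen as the alias that carries the group structure. *)
pose q : X -> Solenoid R w := p.
have p_fin (b : Solenoid R w) : finite_set (q @^-1` [set b]).
  by exists r; exact: p_fib.
have hX := covering_map_hausdorff cov (@solenoid_hausdorff R w).
have cX := finite_covering_compact cov p_fin (@solenoid_compact R w).
have [N [al [N0 al_p al_al al_cvg al_near]]] := local_translation hX cX cov.1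
  (covering_map_open cov) (covering_map_locally_injective cov).
have [n0 [d [d0 dN]]] := nbhs0_tube hw N0.
(* A property that holds near [v] holds at [v] itself, where the translation is 0. *)
have al0 v : al v 0 = v by have /nbhs_singleton := al_near v; rewrite subrr.
have al_p' v u : tube hw n0 d u -> q (al v u) = q v + u.
  by move=> /dN; exact: al_p.
have al_al' v u u' : tube hw n0 d u -> tube hw n0 d u' ->
    tube hw n0 d (u + u') -> al (al v u) u' = al v (u + u').
  by move=> /dN Nu /dN Nu' /dN; exact: al_al.
have [n [D [n0n D0 Dw perP]]] := minimal_period d0 al_p' al_al' al0 p_fin x.
rewrite (orbit_component d0 al_al' al0 al_cvg al_near cov.1 n0n D0 Dw perP).
rewrite -(range_orbit_map d0 al_al' al0 n0n D0 Dw perP).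
apply: (@homeomorphic_range (Solenoid R w)) => //.
- exact: solenoid_compact.
- exact: (orbit_map_continuous d0 al_al' al0 al_cvg n0n D0 perP).
- exact: (orbit_map_inj d0 al_p' al_al' al0 n0n D0 Dw perP).
Qed.
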